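(* Let $d,k\in\mathbb{N}$ and let $W$ be a real symmetric positive definite $k\times k$ matrix with simple eigenvalues (i.e. $k$ distinct eigenvalues). Let $(\omega_n)_{n\in\mathbb{Z}^d}$ be independent, identically distributed real random variables whose common distribution $\mu$ is absolutely continuous with a bounded, compactly supported density $\rho$. On $\ell^2(\mathbb{Z}^d;\mathbb{C}^k)$ define $$(H^A_\omega\phi)(n)=(h_0\phi)(n)+\omega_n W\phi(n),\qquad n\in\mathbb{Z}^d,$$ where $(h_0\phi)(n)=\sum_{m\in\mathbb{Z}^d:\,|m-n|=1}\phi(m)$ is the discrete Laplacian acting componentwise. Then for almost every $\omega$, all eigenvalues of $H^A_\omega$ are simple (have multiplicity one).
   Context: $|m-n|=1$ means $m$ and $n$ are nearest neighbours in $\mathbb{Z}^d$. ''Almost every $\omega$'' refers to the product measure $\bigotimes_{n\in\mathbb{Z}^d}\mu$. *)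

(* Defs.v *)
From HB Require Import structures.
From mathcomp Require Import all_boot all_order all_algebra.
From mathcomp Require Import all_classical all_reals all_analysis.
From mathcomp Require Import complex.
Set Implicit Arguments. Unset Strict Implicit. Unset Printing Implicit Defensive.
Import Order.TTheory GRing.Theory Num.Theory.
Local Open Scope ring_scope.
Local Open Scope classical_set_scope.
Local Open Scope complex_scope.

Definition Zd (d : nat) := 'rV[int]_d.

Definition unitZ (d : nat) (i : 'I_d) : Zd d := delta_mx 0 i.

Definition nn (d : nat) (m n : Zd d) : Prop := (\sum_(i < d) `|m 0 i - n 0 i|) = 1.

(* Discrete Laplacian acting componentwise on phi : Z^d -> C^k :
   (h0 phi)(n) = sum_{|m-n|=1} phi(m) = sum_i (phi(n+e_i) + phi(n-e_i)). *)
Definition laplacian (R : rcfType) (d k : nat) (phi : Zd d -> 'cV[R[i]]_k)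
  (n : Zd d) : 'cV[R[i]]_k :=
  \sum_(i < d) (phi (n + unitZ i) + phi (n - unitZ i)).

Definition HA (R : rcfType) (d k : nat) (W : 'M[R]_k) (om : Zd d -> R)
  (phi : Zd d -> 'cV[R[i]]_k) (n : Zd d) : 'cV[R[i]]_k :=
  laplacian phi n + ((om n)%:C *: (map_mx (fun x : R => x%:C) W *m phi n)).

Definition sqnorm (R : rcfType) (k : nat) (v : 'cV[R[i]]_k) : R :=
  \sum_(j < k) (complex.Re (v j 0) ^+ 2 + complex.Im (v j 0) ^+ 2).

Definition in_l2 (R : rcfType) (d k : nat) (phi : Zd d -> 'cV[R[i]]_k) : Prop :=
  exists M : R, forall s : seq (Zd d), uniq s -> \sum_(n <- s) sqnorm (phi n) <= M.

Definition eigenvector_of (R : rcfType) (d k : nat) (H : (Zd d -> 'cV[R[i]]_k) -> Zd d -> 'cV[R[i]]_k)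
  (E : R[i]) (phi : Zd d -> 'cV[R[i]]_k) : Prop :=
  in_l2 phi /\ (exists n, phi n != 0) /\ (forall n, H phi n = E *: phi n).

Definition all_eigenvalues_simple (R : rcfType) (d k : nat)
  (H : (Zd d -> 'cV[R[i]]_k) -> Zd d -> 'cV[R[i]]_k) : Prop :=
  forall (E : R[i]) (phi psi : Zd d -> 'cV[R[i]]_k),
    eigenvector_of H E phi -> eigenvector_of H E psi ->
    exists c : R[i], forall n, psi n = c *: phi n.

Definition sym_posdef (R : realType) (k : nat) (W : 'M[R]_k) : Prop :=
  W^T = W /\ forall v : 'cV[R]_k, v != 0 -> 0 < (v^T *m W *m v) 0 0.

Definition simple_spectrum (R : realType) (k : nat) (W : 'M[R]_k) : Prop :=
  exists s : seq R, [/\ uniq s, size s = k & all (eigenvalue W) s].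

Definition mutually_independent (R : realType) (dT : measure_display)
  (T : measurableType dT) (P : probability T R) (I : eqType) (X : I -> T -> R) : Prop :=
  forall (s : seq I) (A : I -> set R), uniq s -> (forall i, measurable (A i)) ->
    P (\bigcap_(i in [set` s]) (X i @^-1` A i)) = (\prod_(i <- s) P (X i @^-1` A i))%E.

Definition bdd_cpt_density (R : realType) (rho : R -> R) : Prop :=
  measurable_fun setT rho /\ (forall x, 0 <= rho x) /\
  (exists M : R, forall x, rho x <= M) /\
  (exists a b : R, forall x, (x < a \/ b < x) -> rho x = 0) /\
  (\int[lebesgue_measure]_x (rho x)%:E = 1)%E.

Definition has_density (R : realType) (dT : measure_display) (T : measurableType dT)
  (P : probability T R) (X : T -> R) (rho : R -> R) : Prop :=
  forall A : set R, measurable A ->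
    (P (X @^-1` A) = \int[lebesgue_measure]_(x in A) (rho x)%:E)%E.

(* Main.v *)
(* An eigenvector row of W, with eigenvalue lam > 0, turns an eigenvector of
   HA W om into an l2 solution of the scalar equation
   lap f + lam om f = E f. Vary the coupling a = om n at one site only. If unit
   vectors f, g solve the equations for lam, mu with the same energy E when
   om n = a, and f', g' do so with energy E' when om n = b, Green's identity
   gives
     lam (a - b) f(n) f'(n) = (E - E') <f, f'>,
     mu (a - b) g(n) g'(n) = (E - E') <g, g'>,
   hence for a <> b
     lam f(n) f'(n) <g, g'> = mu g(n) g'(n) <f, f'>.
   If the slopes lam f(n)^2 and mu g(n)^2 differ, this fails at
   (f', g') = (f, g), hence, by weak continuity, for all (f', g') in a
   neighbourhood of (f, g). The unit ball being compact and metrizable for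
   pointwise convergence, only countably many values of om n allow for distinct
   slopes. By compactness the set of such om is measurable, and Fubini's theorem
   makes it negligible.

   When the slopes agree at all sites, summing over the sites gives lam = mu,
   and the combination of f and g that vanishes at a site where f does not
   must be 0. *)
Require Import Defs.
From HB Require Import structures.
From mathcomp Require Import finmap.
From mathcomp Require Import all_boot all_order all_algebra.
From mathcomp Require Import all_classical all_reals all_analysis.
From mathcomp Require Import measurable_realfun summability.
From mathcomp Require Import complex ring lra.
Import Order.TTheory GRing.Theory Num.Theory.
Import numFieldNormedType.Exports.
Local Open Scope ring_scope.
Local Open Scope classical_set_scope.
Set Implicit Arguments.
Unset Strict Implicit.
Unset Printing Implicit Defensive.

#[local] Existing Instance totally_filter.

Lemma fset_exhaustion (J : countType) :
  exists A : nat -> {fset J}, forall j, \forall n \near \oo, j \in A n.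
Proof.
exists (fun n => [fset j in pmap unpickle (iota 0 n)]%fset) => j.
exists (pickle j).+1 => // n /= jn; rewrite !inE mem_pmap; apply/mapP.
by exists (pickle j); rewrite ?pickleK// mem_iota.
Qed.

Section CompactPseudoMetric.
Variables (R : realType) (Z : pseudoMetricType R) (K : set Z).
Hypothesis compactK : compact K.

Lemma compact_totally_bounded (e : R) : 0 < e ->
  exists2 A : {fset Z}, [set` A] `<=` K &
    forall x, K x -> exists2 c, c \in A & ball c e x.
Proof.
move=> e0.
pose covers (A : {fset Z}) x := exists c, [/\ c \in A, K c & ball c e x].
have [A coverK] : exists A, K `<=` covers A.
  apply: (@filter_ex _ totally).
  apply: (iffLR (compact_near_coveringP K) compactK _ totally) => x Kx.
  exists (ball x e, [set A | [fset x] `<=` A]%fset) => /=.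
    by split; [exact: nbhsx_ballx|exists [fset x]%fset].
  move=> [y A] /= [xy xA]; exists x; split=> //.
  by rewrite -fsub1set.
exists [fset c in A | `[< K c >]]%fset.
  by move=> c /=; rewrite !inE => /andP[_ /asboolP].
move=> x /coverK[c [cA Kc cx]]; exists c => //.
by rewrite !inE cA; exact/asboolP.
Qed.

Lemma compact_separable :
  exists D, [/\ countable D, D `<=` K & K `<=` closure D].
Proof.
have /choice[A netA] : forall n, exists A : {fset Z}, [set` A] `<=` K /\
    forall x, K x -> exists2 c, c \in A & ball c (n.+1%:R^-1 : R) x.
  by move=> n; have [|A AK] := @compact_totally_bounded n.+1%:R^-1; [|exists A].
exists (\bigcup_n [set` A n]); split.
- by apply: bigcup_countable => // n _; exact/finite_set_countable.
- by move=> c [n _]; exact: (netA n).1.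
move=> x Kx V /nbhs_ballP[e e0 eV].
have [n _ ne] := near_infty_natSinv_lt (PosNum e0).
have [c cA cx] := (netA n).2 x Kx; exists c; split; first by exists n.
by apply/eV/ball_sym/(le_ball _ cx)/ltW/ne => /=.
Qed.

Lemma countable_isolated (T : Type) (S : set T) (h : T -> Z) :
  (forall a, S a -> K (h a)) ->
  (forall a, S a -> \forall z \near h a, forall b, S b -> h b = z -> b = a) ->
  countable S.
Proof.
move=> SK isolated; have [D [countD _ KD]] := compact_separable.
have /choice[code codeP] : forall a, exists rc : nat * Z, S a ->
    [/\ D rc.2, ball (h a) (rc.1.+1%:R^-1 / 2 : R) rc.2 &
        forall b, S b -> ball (h a) (rc.1.+1%:R^-1 : R) (h b) -> b = a].
  move=> a; have [Sa|nSa] := pselect (S a); last by exists (0%N, h a).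
  have /nbhs_ballP[e e0 e_isolated] := isolated a Sa.
  have [r _ re] := near_infty_natSinv_lt (PosNum e0).
  have [|c [Dc ac]] := KD _ (SK a Sa) (ball (h a) (r.+1%:R^-1 / 2)).
    by apply: nbhsx_ballx; rewrite divr_gt0.
  exists (r, c); split=> // b Sb ab; apply: (e_isolated (h b)) => //.
  by apply: le_ball ab; apply/ltW/re => /=.
have /countable_injP[f injf] := countD.
apply/countable_injP; exists (fun a => pickle ((code a).1, f (code a).2)).
move=> a b; rewrite !inE => Sa Sb /(pcan_inj pickleK)[radius /injf center].
have [[Da a_c a_isolated] [Db b_c _]] := (codeP a Sa, codeP b Sb).
apply/esym/a_isolated => //; rewrite [_%:R^-1]splitr.
apply: ball_triangle a_c _; rewrite center ?inE//.
by rewrite radius; exact/ball_sym.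
Qed.

Lemma compact_exists_le0 (D : set Z) (J : choiceType) (A : nat -> {fset J})
    (g : J -> Z -> R) :
  D `<=` K -> K `<=` closure D -> (forall j, \forall n \near \oo, j \in A n) ->
  (forall j, continuous (g j)) ->
  (exists2 z, K z & forall j, g j z <= 0) <->
  (forall n, exists2 z, D z & forall j, j \in A n -> g j z < n.+1%:R^-1).
Proof.
move=> DK KD exhaustA contg; split=> [[z Kz gz] n|approx].
  have /(KD _ Kz)[w [Dw gw]] : nbhs z (\bigcap_(j in [set` A n])
      [set w | g j w < n.+1%:R^-1]).
    apply: filter_bigI => j _; apply: (cvgr_lt (g j z) (contg j z)).
    by rewrite (le_lt_trans (gz j)).
  by exists w.
have /choice[z zP] : forall n, exists z,
    D z /\ forall j, j \in A n -> g j z < n.+1%:R^-1.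
  by move=> n; have [z] := approx n; exists z.
have [|p [Kp clusterp]] := compactK (F := z @ \oo) _.
  by exists 0%N => // n _; have [/DK] := zP n.
exists p => // j; rewrite leNgt; apply/negP => gp.
have z_small : \forall n \near \oo, g j (z n) < g j p / 2.
  have e0 : 0 < g j p / 2 by rewrite divr_gt0.
  near=> n; apply: (@lt_trans _ _ n.+1%:R^-1).
    by have [_] := zP n; apply; near: n; exact: exhaustA.
  by near: n; exact: (near_infty_natSinv_lt (PosNum e0)).
have p_large : \forall w \near p, g j p / 2 < g j w.
  by apply: (cvgr_gt (g j p) (contg j p)); lra.
have [w [/= /lt_trans/[apply]]] :=
  clusterp [set w | g j w < _] _ z_small p_large.
by rewrite ltxx.
Unshelve. all: by end_near. Qed.

Lemma measurable_exists_le0 (d : measure_display) (X : measurableType d)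
    (J : countType) (G : J -> X -> Z -> R) :
  (forall j x, continuous (G j x)) ->
  (forall j z, measurable_fun setT (G j ^~ z)) ->
  measurable [set x | exists2 z, K z & forall j, G j x z <= 0].
Proof.
move=> contG measG; have [D [countD DK KD]] := compact_separable.
have [A exhaustA] := fset_exhaustion J.
have -> : [set x | exists2 z, K z & forall j, G j x z <= 0] =
    \bigcap_n \bigcup_(z in D) \bigcap_(j in [set` A n])
      [set x | G j x z < n.+1%:R^-1].
  have approx x := compact_exists_le0 DK KD exhaustA (contG ^~ x).
  apply/seteqP; split=> x => [/approx Gx n _|Gx].
    by have [z] := Gx n; exists z.
  by apply/approx => n; have [z] := Gx n I; exists z.
apply: bigcapT_measurable => n; rewrite bigcup_set_type.
apply: countable_bigcupT_measurable => [|z].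
  by rewrite (eq_countable (card_setT D)).
apply: fin_bigcap_measurable => // j _; rewrite -[X in measurable X]setTI.
by apply: (measurable_fun_ltr (measG j _) (measurable_cst _)) [set true] _.
Qed.

End CompactPseudoMetric.

Section ProductSigmaAlgebra.
Variables (R : realType) (I : eqType).
Implicit Types (s : seq I) (A : I -> set R).

Definition box A : set (I -> R) := [set x | forall i, A i (x i)].

Definition box_support A s :=
  (forall i, measurable (A i)) /\ forall i, i \notin s -> A i = setT.

Definition boxes : set (set (I -> R)) :=
  [set box A | A in [set A | exists s, box_support A s]].

Definition configuration : Type := g_sigma_algebraType boxes.

HB.instance Definition _ := Measurable.on configuration.

Lemma boxes_setI_closed : setI_closed boxes.
Proof.
move=> _ _ [A [s [mA sA]] <-] [A' [s' [mA' s'A']] <-].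
exists (fun i => A i `&` A' i).
  exists (s ++ s'); split=> i; first exact: measurableI.
  by rewrite mem_cat negb_or => /andP[/sA -> /s'A' ->]; rewrite setIT.
by apply/seteqP; split=> x /= => [AA'x|[Ax A'x] i];
  [split=> i; case: (AA'x i)|].
Qed.

Lemma boxes_setT : boxes setT.
Proof. by exists (fun=> setT); [exists [::]|apply/seteqP; split]. Qed.

Lemma preimage_box (Y : Type) (f : Y -> I -> R) A s : box_support A s ->
  f @^-1` box A = \bigcap_(i in [set` s]) (f ^~ i @^-1` A i).
Proof.
move=> [_ sA]; apply/seteqP; split=> y /= => [fy i _|fy i]; first exact: fy.
by have [/fy|/sA ->] := boolP (i \in s).
Qed.

Lemma measurable_configurationP (d : measure_display) (Y : measurableType d)
    (f : Y -> configuration) :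
  measurable_fun setT f <-> forall i, measurable_fun setT (f ^~ i).
Proof.
split=> [mf i _ A mA|mf].
  rewrite -[_ @^-1` _]/(f @^-1` [set x : configuration | A (x i)]).
  apply: mf => //; apply: sub_sigma_algebra.
  exists (fun j => if j == i then A else setT).
    exists [:: i]; split=> j; first by case: ifP.
    by rewrite inE => /negPf ->.
  apply/seteqP; split=> x /= => [/(_ i)|Ax j]; first by rewrite eqxx.
  by case: eqP => // ->.
apply: (@measurability _ _ Y configuration setT f boxes) => //.
move=> _ [_ [A [s As] <-] <-]; rewrite setTI (preimage_box _ As).
apply: fin_bigcap_measurable => // i _; rewrite -[X in measurable X]setTI.
by apply: mf => //; exact: As.1.
Qed.

End ProductSigmaAlgebra.

Section Resampling.
Variables (R : realType) (I : eqType) (dT : measure_display).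
Variables (T : measurableType dT) (P : probability T R) (X : I -> T -> R).
Hypothesis mX : forall i, measurable_fun setT (X i).
Hypothesis indepX : mutually_independent P X.
Variable n : I.
Implicit Types (A : I -> set R) (s : seq I) (B : set (configuration R I)).

Let law : probability R R := distribution P (mfun_Sub (mem_set (mX n))).

Let config (t : T) : configuration R I := X ^~ t.

Let resample (z : T * R) : configuration R I := [eta X ^~ z.1 with n |-> z.2].

Lemma measurable_config : measurable_fun setT config.
Proof. exact/measurable_configurationP. Qed.

Lemma measurable_resample : measurable_fun setT resample.
Proof.
apply/measurable_configurationP => i; rewrite /resample /=.
case: (eqVneq i n) => _; first exact: measurable_snd.
exact: measurableT_comp.
Qed.

Lemma prob_resample_box A s : box_support A s ->
  P (config @^-1` box A) = (P \x law)%E (resample @^-1` box A).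
Proof.
move=> As; pose others := [seq i <- undup s | i != n].
have Aothers : box_support A (n :: others).
  split=> [|i]; first exact: As.1.
  rewrite inE negb_or mem_filter mem_undup => /andP[-> /= is_].
  exact: As.2.
pose C := \bigcap_(i in [set` others]) (X i @^-1` A i).
have mC : measurable C.
  apply: fin_bigcap_measurable => // i _; rewrite -[X in measurable X]setTI.
  by apply: mX => //; exact: As.1.
have -> : resample @^-1` box A = C `*` A n.
  apply/seteqP; rewrite /resample; split=> -[t a] /= => [Ata|[Ct Aa] i].
    split=> [i /=|]; last by have := Ata n; rewrite /= eqxx.
    by rewrite mem_filter => /andP[/negPf ni _]; have := Ata i; rewrite /= ni.
  rewrite /=; case: (eqVneq i n) => [->//|ni].
  have [/Ct//|io] := boolP (i \in others).
  by rewrite Aothers.2// inE negb_or ni.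
have uniq_sites : uniq (n :: others).
  by rewrite /= mem_filter eqxx filter_uniq ?undup_uniq.
rewrite (preimage_box _ Aothers) (indepX uniq_sites As.1) big_cons.
rewrite -(indepX _ As.1); last by case/andP: uniq_sites.
by rewrite product_measure1E//; [exact: muleC|exact: As.1].
Qed.

(* Independence allows one to replace [X n] by an independent copy of itself. *)
Lemma prob_resample B : measurable B ->
  P (config @^-1` B) = (P \x law)%E (resample @^-1` B).
Proof.
move=> mB.
pose config_mfun : {mfun T >-> configuration R I} :=
  mfun_Sub (mem_set measurable_config).
pose resample_mfun : {mfun (T * R)%type >-> configuration R I} :=
  mfun_Sub (mem_set measurable_resample).
rewrite -[LHS]/(distribution P config_mfun B).
rewrite -[RHS]/(distribution (P \x law)%E resample_mfun B).
apply: (@g_sigma_algebra_measure_unique _ R (configuration R I) (@boxes R I) _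
  (fun=> setT)) => //.
- by move=> ? ?; exact: sub_sigma_algebra.
- by move=> _; exact: boxes_setT.
- by apply: bigcup_const; exists 0%N.
- exact: boxes_setI_closed.
- by move=> _ [A [s As] <-]; exact: prob_resample_box As.
- by move=> _; rewrite (le_lt_trans (probability_le1 _ _))// ltry.
Qed.

Lemma null_of_null_sections B : measurable B ->
  (forall x : I -> R, P (X n @^-1` [set a | B [eta x with n |-> a]]) = 0%E) ->
  P [set t | B (X ^~ t)] = 0%E.
Proof.
move=> mB nullB; rewrite (prob_resample mB).
rewrite [LHS]integral0_eq// => t _; rewrite -[RHS](nullB (X ^~ t)).
by congr (P _); apply/seteqP; split=> t'; rewrite /xsection /= inE.
Qed.

End Resampling.

Definition has_sum (R : realType) (I : choiceType) (u : I -> R) (x : R) :=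
  partial_sum u @ totally --> x.

Section UnorderedSums.
Variables (R : realType) (I : choiceType).
Implicit Types (u v : I -> R) (x y c : R) (A B : {fset I}).

Lemma partial_sumE u A : partial_sum u A = \sum_(i <- A) u i.
Proof. by rewrite /partial_sum big_seq_fsetE. Qed.

Lemma ler_sum_fsubset u A B : (forall i, 0 <= u i) -> (A `<=` B)%fset ->
  \sum_(i <- A) u i <= \sum_(i <- B) u i.
Proof.
move=> u0 AB; rewrite (eq_big_seq (fun i => if i \in A then u i else 0)).
  rewrite (big_fset_incl _ AB) => [|i _ /negPf -> //].
  by apply: ler_sum => i _; case: ifP.
by move=> i ->.
Qed.

Lemma has_sum_unique u x y : has_sum u x -> has_sum u y -> x = y.
Proof. exact: (@cvg_unique _ (@norm_hausdorff _ R)). Qed.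

Lemma has_sumD u v x y :
  has_sum u x -> has_sum v y -> has_sum (u \+ v) (x + y).
Proof.
rewrite /has_sum.
have -> : partial_sum (u \+ v) = partial_sum u \+ partial_sum v.
  by apply/funext => A; rewrite /partial_sum big_split.
exact: cvgD.
Qed.

Lemma has_sumB u v x y :
  has_sum u x -> has_sum v y -> has_sum (u \- v) (x - y).
Proof.
rewrite /has_sum.
have -> : partial_sum (u \- v) = partial_sum u \- partial_sum v.
  by apply/funext => A; rewrite /partial_sum sumrB.
exact: cvgB.
Qed.

Lemma has_sumZ c u x : has_sum u x -> has_sum (c \*o u) (c * x).
Proof.
rewrite /has_sum.
have -> : partial_sum (c \*o u) = c \*o partial_sum u.
  by apply/funext => A; rewrite /partial_sum /= mulr_sumr.
by apply: cvgM => //; exact: cvg_cst.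
Qed.

Lemma has_sum_big (J : Type) (r : seq J) (F : J -> I -> R) (X : J -> R) :
  (forall j, has_sum (F j) (X j)) ->
  has_sum (fun i => \sum_(j <- r) F j i) (\sum_(j <- r) X j).
Proof.
move=> FX; rewrite /has_sum.
have -> : partial_sum (fun i => \sum_(j <- r) F j i) =
    fun A => \sum_(j <- r) partial_sum (F j) A.
  by apply/funext => A; exact: exchange_big.
by apply: cvg_big => [|j _]; [exact: add_continuous|exact: FX].
Qed.

Lemma has_sum_fset A u :
  has_sum (fun i => if i \in A then u i else 0) (\sum_(i <- A) u i).
Proof.
apply: cvg_near_cst; exists A => // B /= AB; rewrite partial_sumE.
rewrite -(big_fset_incl _ AB) => [|i _ /negPf -> //].
by apply: eq_big_seq => i ->.
Qed.

Lemma has_sum_reindex (h h' : I -> I) u x :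
  cancel h h' -> cancel h' h -> has_sum u x -> has_sum (u \o h) x.
Proof.
move=> hK h'K ux; rewrite /has_sum.
have -> : partial_sum (u \o h) = partial_sum u \o (fun A => h @` A)%fset.
  apply/funext => A /=; rewrite !partial_sumE big_imfset//=.
  by move=> i j _ _; exact: (can_inj hK).
apply: cvg_comp ux => B [A _ AB]; exists (h' @` A)%fset => // C /= AC.
apply: AB => /=; apply/fsubsetP => i iA; apply/imfsetP; exists (h' i).
  by apply: (fsubsetP AC); apply/imfsetP; exists i.
by rewrite h'K.
Qed.

Lemma has_sum_le u x c : has_sum u x ->
  (forall A, \sum_(i <- A) u i <= c) -> x <= c.
Proof.
move=> ux uc; rewrite -(cvg_lim (@norm_hausdorff _ R) ux).
apply: limr_le; first exact: cvgP ux.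
by apply: nearW => A; rewrite partial_sumE.
Qed.

Lemma has_sum_ge u x A : (forall i, 0 <= u i) -> has_sum u x ->
  \sum_(i <- A) u i <= x.
Proof.
move=> u0 ux; rewrite -(cvg_lim (@norm_hausdorff _ R) ux).
apply: limr_ge; first exact: cvgP ux.
by exists A => // B /= AB; rewrite partial_sumE ler_sum_fsubset.
Qed.

Lemma has_sum_bounded u c : (forall i, 0 <= u i) ->
  (forall A, \sum_(i <- A) u i <= c) -> exists x, has_sum u x.
Proof.
move=> u0 uc; pose S := range (fun A : {fset I} => \sum_(i <- A) u i).
have supS : has_sup S.
  by split; [exists (\sum_(i <- fset0) u i), fset0|exists c => _ [A _ <-]].
exists (sup S); apply/cvgrPdist_lt => e e0.
have [_ [A _ <-] Ae] := sup_adherent e0 supS.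
exists A => // B /= AB; rewrite partial_sumE ger0_norm ?subr_ge0; last first.
  by apply: sup_ubound; [case: supS|exists B].
by rewrite ltrBlDr -ltrBlDl (lt_le_trans Ae)// ler_sum_fsubset.
Qed.

End UnorderedSums.

(* [c] is the square of the radius. *)
Definition sqball (R : realType) (I : choiceType) (c : R) :
    set {ptws I -> R} :=
  [set f | forall A : {fset I}, \sum_(i <- A) f i ^+ 2 <= c].

Definition l2 (R : realType) (I : choiceType) (f : I -> R) :=
  exists c, sqball c f.

Definition ip (R : realType) (I : choiceType) (f g : I -> R) : R :=
  lim (partial_sum (f \* g) @ totally).

Section L2.
Variables (R : realType) (I : choiceType).
Implicit Types (f g h : I -> R) (x y a b c e : R) (A : {fset I}).

Lemma sqballD b c f g : sqball b f -> sqball c g ->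
  sqball (2 * (b + c)) (f \+ g).
Proof.
move=> fb gc A; have := lerD (fb A) (gc A); rewrite -(ler_pM2l (ltr0n R 2)).
apply: le_trans; rewrite -big_split mulr_sumr; apply: ler_sum => i _ /=.
by have := sqr_ge0 (f i - g i); lra.
Qed.

Lemma sqballZ a c f : sqball c f -> sqball (a ^+ 2 * c) (a \*o f).
Proof.
move=> fc A; under eq_bigr do rewrite exprMn.
by rewrite -mulr_sumr ler_wpM2l ?sqr_ge0.
Qed.

Lemma sqballB b c f g : sqball b f -> sqball c g ->
  sqball (2 * (b + c)) (f \- g).
Proof.
move=> fb /(sqballZ (-1)); rewrite sqrrN expr1n mul1r => /(sqballD fb).
by congr sqball; apply/funext => i /=; rewrite mulN1r.
Qed.

Lemma sqball_ge0 c f : sqball c f -> 0 <= c.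
Proof. by move=> /(_ fset0); rewrite big_seq_fset0. Qed.

Lemma sqball_coord c f i : sqball c f -> f i ^+ 2 <= c.
Proof. by move=> /(_ [fset i]%fset); rewrite big_seq_fset1. Qed.

Lemma l2D f g : l2 f -> l2 g -> l2 (f \+ g).
Proof. by move=> [b fb] [c gc]; exists (2 * (b + c)); exact: sqballD. Qed.

Lemma l2B f g : l2 f -> l2 g -> l2 (f \- g).
Proof. by move=> [b fb] [c gc]; exists (2 * (b + c)); exact: sqballB. Qed.

Lemma l2Z a f : l2 f -> l2 (a \*o f).
Proof. by move=> [c fc]; exists (a ^+ 2 * c); exact: sqballZ. Qed.

Lemma l2_le f g : (forall i, f i ^+ 2 <= g i ^+ 2) -> l2 g -> l2 f.
Proof.
by move=> fg [c gc]; exists c => A; apply: le_trans (gc A); exact: ler_sum.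
Qed.

Lemma l2_sum (J : Type) (r : seq J) (F : J -> I -> R) :
  (forall j, l2 (F j)) -> l2 (fun i => \sum_(j <- r) F j i).
Proof.
move=> lF; elim: r => [|j r IHr].
  by exists 0 => A; rewrite big1// => i _; rewrite big_nil expr0n.
by under eq_fun do rewrite big_cons; exact: l2D.
Qed.

Lemma l2_inj (h : I -> I) f : injective h -> l2 f -> l2 (f \o h).
Proof.
move=> injh [c fc]; exists c => A.
by have := fc (h @` A)%fset; rewrite big_imfset//= => i j _ _ /injh.
Qed.

Lemma has_sum_ip f g : l2 f -> l2 g -> has_sum (f \* g) (ip f g).
Proof.
move=> lf lg; suff [x fgx] : exists x, has_sum (f \* g) x.
  exact: (cvgP x fgx).
have [b fgb] := l2D lf lg; have [c fgc] := l2B lf lg.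
have [x fgx] := has_sum_bounded (fun i => sqr_ge0 _) fgb.
have [y fgy] := has_sum_bounded (fun i => sqr_ge0 _) fgc.
exists (4^-1 * (x - y)); have := has_sumZ (c := 4^-1) (has_sumB fgx fgy).
by congr has_sum; apply/funext => i /=; field.
Qed.

Lemma ip_unique f g x : has_sum (f \* g) x -> ip f g = x.
Proof. by move=> fgx; apply: cvg_lim fgx; exact: norm_hausdorff. Qed.

Lemma ipC f g : ip f g = ip g f.
Proof.
by rewrite /ip (_ : f \* g = g \* f)//; apply/funext => i; exact: mulrC.
Qed.

Lemma ipDr f g h : l2 f -> l2 g -> l2 h -> ip f (g \+ h) = ip f g + ip f h.
Proof.
move=> lf lg lh; apply: ip_unique.
have := has_sumD (has_sum_ip lf lg) (has_sum_ip lf lh).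
by congr has_sum; apply/funext => i /=; rewrite mulrDr.
Qed.

Lemma ipBr f g h : l2 f -> l2 g -> l2 h -> ip f (g \- h) = ip f g - ip f h.
Proof.
move=> lf lg lh; apply: ip_unique.
have := has_sumB (has_sum_ip lf lg) (has_sum_ip lf lh).
by congr has_sum; apply/funext => i /=; rewrite mulrBr.
Qed.

Lemma ipZr a f g : l2 f -> l2 g -> ip f (a \*o g) = a * ip f g.
Proof.
move=> lf lg; apply: ip_unique; have := has_sumZ (c := a) (has_sum_ip lf lg).
by congr has_sum; apply/funext => i /=; rewrite mulrCA.
Qed.

Lemma ipDl f g h : l2 f -> l2 g -> l2 h -> ip (f \+ g) h = ip f h + ip g h.
Proof. by move=> lf lg lh; rewrite ipC ipDr// !(ipC h). Qed.

Lemma ipZl a f g : l2 f -> l2 g -> ip (a \*o f) g = a * ip f g.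
Proof. by move=> lf lg; rewrite ipC ipZr// (ipC g). Qed.

Lemma sqball_ip f : l2 f -> sqball (ip f f) f.
Proof.
move=> lf A; under eq_bigr do rewrite expr2.
apply: (@has_sum_ge _ _ (f \* f)); last exact: has_sum_ip.
by move=> i; rewrite /= -expr2 sqr_ge0.
Qed.

Lemma ip_le_sqball c f : sqball c f -> ip f f <= c.
Proof.
move=> fc; have lf : l2 f by exists c.
apply: (has_sum_le (has_sum_ip lf lf)) => A.
by under eq_bigr do rewrite /= -expr2.
Qed.

Lemma ip_ge0 f : l2 f -> 0 <= ip f f.
Proof. by move=> lf; exact: sqball_ge0 (sqball_ip lf). Qed.

Lemma ip_eq0 f : l2 f -> ip f f = 0 -> forall i, f i = 0.
Proof.
move=> lf f0 i; apply/eqP; rewrite -sqrf_eq0 eq_le sqr_ge0 andbT -f0.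
exact/sqball_coord/sqball_ip.
Qed.

Lemma ip_gt0 f i : l2 f -> f i != 0 -> 0 < ip f f.
Proof.
move=> lf fi0; rewrite lt_def ip_ge0// andbT.
by apply: contra fi0 => /eqP f0; rewrite (ip_eq0 lf f0).
Qed.

Lemma cauchy_schwarz f g : l2 f -> l2 g -> ip f g ^+ 2 <= ip f f * ip g g.
Proof.
move=> lf lg; suff : (2 * ip f g) ^+ 2 - 4 * ip g g * ip f f <= 0 by lra.
pose p := Poly [:: ip f f; 2 * ip f g; ip g g].
have -> : ip g g = p`_2 by rewrite !coefE.
have -> : 2 * ip f g = p`_1 by rewrite !coefE.
have -> : ip f f = p`_0 by rewrite !coefE.
rewrite deg_le2_poly_ge0 ?size_Poly// => r.
have lrg : l2 (r \*o g) by exact: l2Z.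
have := ip_ge0 (l2D lf lrg); rewrite horner_Poly/= ipDl ?ipDr ?ipZl ?ipZr//.
  by rewrite (ipC g f); lra.
exact: l2D.
Qed.

Lemma norm_ip_lt f g c e : l2 f -> sqball c g -> 0 < e ->
  ip f f * c < e ^+ 2 -> `|ip f g| < e.
Proof.
move=> lf gc e0 fce; have lg : l2 g by exists c.
rewrite -ltr_sqr ?nnegrE ?(ltW e0)// real_normK ?num_real//.
apply: le_lt_trans (cauchy_schwarz lf lg) (le_lt_trans _ fce).
exact: (ler_wpM2l (ip_ge0 lf) (ip_le_sqball gc)).
Qed.

Definition tail A f : I -> R := fun i => if i \in A then 0 else f i.

Lemma l2_tail A f : l2 f -> l2 (tail A f).
Proof.
apply: l2_le => i.
by rewrite /tail; case: ifP; rewrite ?expr0n ?sqr_ge0.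
Qed.

Lemma ip_tail A f g : l2 f -> l2 g ->
  ip f g = \sum_(i <- A) f i * g i + ip (tail A f) g.
Proof.
move=> lf lg; apply: ip_unique.
have := has_sumD (has_sum_fset (A := A) (u := f \* g))
  (has_sum_ip (l2_tail A lf) lg).
congr has_sum; apply/funext => i; rewrite /tail /=.
by case: ifP; rewrite ?mul0r ?addr0 ?add0r.
Qed.

Lemma ip_tail_lt f e : l2 f -> 0 < e ->
  exists A, ip (tail A f) (tail A f) < e.
Proof.
move=> lf e0; have /cvgrPdist_lt/(_ e e0) := has_sum_ip lf lf.
move=> /(filter_ex (F := totally))[A]; rewrite partial_sumE ltr_norml.
move=> /andP[_ fA]; exists A; have lt := l2_tail A lf.
have -> : ip (tail A f) (tail A f) = ip f (tail A f).
  rewrite [RHS](ip_tail A)// big1_seq ?add0r// => i /=.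
  by rewrite /tail => ->; rewrite mulr0.
by rewrite ipC; move: fA; rewrite {1}(ip_tail A)//; lra.
Qed.

Lemma cvg_ip (T : Type) (F : set_system T) {FF : Filter F}
    f (g_ : T -> I -> R) g c :
  l2 f -> sqball c g -> (\forall t \near F, sqball c (g_ t)) ->
  (forall i, g_ t i @[t --> F] --> g i) ->
  ip f (g_ t) @[t --> F] --> ip f g.
Proof.
move=> lf gc ball_g cvgg; have c0 := sqball_ge0 gc; have lg : l2 g by exists c.
apply/cvgrPdist_lt => e e0; have e20 : 0 < e / 2 by rewrite divr_gt0.
have c1 : 0 < 2 * (c + c) + 1 by lra.
have [A tailA] := ip_tail_lt lf (divr_gt0 (exprn_gt0 2 e20) c1).
have ltf := l2_tail A lf.
have /cvgrPdist_lt/(_ _ e20) head_small :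
    \sum_(i <- A) f i * g_ t i @[t --> F] --> \sum_(i <- A) f i * g i.
  apply: cvg_big => [|i _]; first exact: add_continuous.
  by apply: cvgM => //; exact: cvg_cst.
near=> t.
have gtc : sqball c (g_ t) by near: t.
have lgt : l2 (g_ t) by exists c.
have tail_small : `|ip (tail A f) (g \- g_ t)| < e / 2.
  apply: (norm_ip_lt ltf (sqballB gc gtc) e20).
  rewrite ltr_pdivlMr// in tailA; apply: le_lt_trans tailA.
  by apply: (ler_wpM2l (ip_ge0 ltf)); lra.
have /= -> : ip f g - ip f (g_ t) = ip (tail A f) (g \- g_ t) +
    (\sum_(i <- A) f i * g i - \sum_(i <- A) f i * g_ t i).
  by rewrite ipBr// (ip_tail A lf lg) (ip_tail A lf lgt); ring.
rewrite (le_lt_trans (ler_normD _ _))// [e]splitr ltrD//.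
by near: t.
Unshelve. all: by end_near. Qed.

Lemma continuous_coord i : continuous (fun f : {ptws I -> R} => f i).
Proof. exact: (@proj_continuous I (fun=> R)). Qed.

Lemma cvg_coord (T : Type) (F : set_system T) (f_ : T -> {ptws I -> R})
    (f : {ptws I -> R}) i :
  f_ t @[t --> F] --> f -> f_ t i @[t --> F] --> f i.
Proof. by move=> cvgf; exact: (cvg_comp _ _ cvgf (@continuous_coord i f)). Qed.

Lemma continuous_sumsq A :
  continuous (fun f : {ptws I -> R} => \sum_(i <- A) f i ^+ 2).
Proof.
apply: continuous_big => [|i _ f]; first exact: add_continuous.
exact: (continuous_comp (@continuous_coord i f) (@exprn_continuous _ 2 _)).
Qed.

Lemma compact_sqball c : compact (@sqball R I c).
Proof.
have compact_box :=
  tychonoff (fun i : I => @segment_compact R (- (1 + c)) (1 + c)).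
apply: (subclosed_compact _ compact_box) => [|f fc i].
  have -> : @sqball R I c =
      \bigcap_(A in [set: {fset I}]) [set f | \sum_(i <- A) f i ^+ 2 <= c].
    by apply/seteqP; split=> f fc A => [_|]; exact: fc.
  apply: closed_bigI => A _; apply: preimage_closed (@closed_le _ c) => f _.
  exact: continuous_sumsq.
rewrite /= in_itv/= -ler_norml -ler_sqr ?nnegrE ?addr_ge0 ?(sqball_ge0 fc)//.
rewrite real_normK ?num_real// (le_trans (sqball_coord i fc))//.
by have := sqball_ge0 fc; nra.
Qed.

End L2.

Section Shift.
Variables (R : realType) (G : zmodType).
Implicit Types (c : G) (f g : G -> R).

Lemma l2_shift c f : l2 f -> l2 (fun x => f (x + c)).
Proof. exact/l2_inj/addIr. Qed.

Lemma ip_shift c f g : l2 f -> l2 g ->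
  ip (fun x => f (x + c)) g = ip f (fun x => g (x - c)).
Proof.
move=> lf lg; apply/esym/ip_unique.
have := has_sum_reindex (subrK c) (addrK c) (has_sum_ip (l2_shift c lf) lg).
by congr has_sum; apply/funext => x /=; rewrite subrK.
Qed.

End Shift.

Section LatticeLaplacian.
Variable d : nat.

Definition lap (V : zmodType) (u : Zd d -> V) (m : Zd d) : V :=
  \sum_(i < d) (u (m + unitZ i) + u (m - unitZ i)).

Lemma lap_additive (V V' : zmodType) (f : {additive V -> V'}) u m :
  lap (f \o u) m = f (lap u m).
Proof. by rewrite raddf_sum; apply: eq_bigr => i _; rewrite raddfD. Qed.

Lemma lapD (V : zmodType) (u v : Zd d -> V) m :
  lap (u \+ v) m = lap u m + lap v m.
Proof. by rewrite -big_split; apply: eq_bigr => i _; rewrite addrACA. Qed.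

Lemma lapZ (F : nzRingType) (a : F) (u : Zd d -> F) m :
  lap (a \*o u) m = a * lap u m.
Proof. by rewrite mulr_sumr; apply: eq_bigr => i _; rewrite mulrDr. Qed.

Definition eigen_eq (F : nzRingType) (V : Zd d -> F) (E : F) (u : Zd d -> F) :=
  forall m, lap u m + V m * u m = E * u m.

End LatticeLaplacian.

Section ScalarModel.
Variables (R : realType) (d : nat).
Implicit Types (f g om V : Zd d -> R) (lam mu E a b : R) (n m : Zd d).

Lemma has_sum_green f g : l2 f -> l2 g ->
  has_sum (lap f \* g \- f \* lap g) 0.
Proof.
move=> lf lg; have green_direction (i : 'I_d) : has_sum (fun m =>
    (f (m + unitZ i) + f (m - unitZ i)) * g m -
    f m * (g (m + unitZ i) + g (m - unitZ i))) 0.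
  have shift_f c := has_sum_ip (l2_shift c lf) lg.
  have shift_g c := has_sum_ip lf (l2_shift c lg).
  have := has_sumB (has_sumD (shift_f (unitZ i)) (shift_f (- unitZ i)))
    (has_sumD (shift_g (unitZ i)) (shift_g (- unitZ i))).
  rewrite !ip_shift// opprK [X in _ - X]addrC subrr.
  by congr has_sum; apply/funext => m /=; ring.
have := has_sum_big (r := index_enum 'I_d) green_direction.
rewrite big1//; congr has_sum; apply/funext => m /=.
by rewrite sumrB -mulr_suml -mulr_sumr.
Qed.

Definition l2sol V E f := l2 f /\ eigen_eq V E f.

Lemma l2solD V E f g : l2sol V E f -> l2sol V E g -> l2sol V E (f \+ g).
Proof.
move=> [lf Vf] [lg Vg]; split=> [|m]; first exact: l2D.
by rewrite lapD/= !mulrDr addrACA Vf Vg.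
Qed.

Lemma l2solZ V E a f : l2sol V E f -> l2sol V E (a \*o f).
Proof.
move=> [lf Vf]; split=> [|m]; first exact: l2Z.
by rewrite lapZ/= [RHS]mulrCA -Vf mulrDr mulrCA.
Qed.

Lemma l2sol_perturbation n V V' E E' f f' :
  (forall m, m != n -> V m = V' m) -> l2sol V E f -> l2sol V' E' f' ->
  (V n - V' n) * (f n * f' n) = (E - E') * ip f f'.
Proof.
move=> VV' [lf Vf] [lf' Vf'].
have := has_sumD (has_sum_green lf lf')
  (has_sum_fset (A := [fset n]%fset) (u := (V \- V') \* (f \* f'))).
rewrite big_seq_fset1 add0r => /has_sum_unique; apply.
have := has_sumZ (c := E - E') (has_sum_ip lf lf').
congr has_sum; apply/funext => m /=; rewrite inE.
rewrite (canRL (addrK _) (Vf m)) (canRL (addrK _) (Vf' m)).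
by case: (eqVneq m n) => [->|/VV' ->]; ring.
Qed.

Definition unit_l2sol V E f := l2sol V E f /\ ip f f = 1.

Lemma l2sol_normalize V E f : l2sol V E f -> 0 < ip f f ->
  unit_l2sol V E ((Num.sqrt (ip f f))^-1 \*o f).
Proof.
move=> Vf f0; have [lf _] := Vf; split; first exact: l2solZ.
rewrite ipZl ?ipZr//; last exact: l2Z.
by rewrite mulrA -expr2 exprVn sqr_sqrtr ?ltW// mulVf ?gt_eqF.
Qed.

Local Notation pair_space := ({ptws Zd d -> R} * {ptws Zd d -> R})%type.

(* By the Feynman-Hellmann formula, [lam * f n ^+ 2] is the derivative of the
   eigenvalue [E] with respect to [om n] when [f] is a unit vector. *)
Definition mismatched_pair lam mu n om (z : pair_space) :=
  exists E, [/\ unit_l2sol (lam \*o om) E z.1, unit_l2sol (mu \*o om) E z.2 &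
    mu * z.2 n ^+ 2 < lam * z.1 n ^+ 2].

Definition slope_mismatch lam mu n om :=
  exists z, mismatched_pair lam mu n om z.

Lemma slope_mismatch_of_l2sol lam mu n om E f g : 0 <= lam -> 0 <= mu ->
  l2sol (lam \*o om) E f -> l2sol (mu \*o om) E g ->
  mu * g n ^+ 2 * ip f f < lam * f n ^+ 2 * ip g g ->
  slope_mismatch lam mu n om.
Proof.
move=> lam0 mu0 lamf mug fg; have [[lf _] [lg _]] := (lamf, mug).
have fg0 := le_lt_trans
  (mulr_ge0 (mulr_ge0 mu0 (sqr_ge0 (g n))) (ip_ge0 lf)) fg.
have g0 : 0 < ip g g.
  rewrite lt_def ip_ge0// andbT; apply: contraTneq fg0 => ->.
  by rewrite mulr0 ltxx.
have f0 : 0 < ip f f.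
  apply: (ip_gt0 (i := n)) => //; apply: contraTneq fg0 => ->.
  by rewrite expr0n/= mulr0 mul0r ltxx.
exists ((Num.sqrt (ip f f))^-1 \*o f, (Num.sqrt (ip g g))^-1 \*o g), E.
split; [exact: l2sol_normalize..|].
rewrite /= !exprMn !exprVn !sqr_sqrtr ?ltW// ![_ * (_^-1 * _)]mulrCA.
by rewrite ![_^-1 * _]mulrC ltr_pdivrMr// mulrAC ltr_pdivlMr.
Qed.

Definition mismatch_form lam mu n (z w : pair_space) : R :=
  lam * (z.1 n * w.1 n) * ip z.2 w.2 - mu * (z.2 n * w.2 n) * ip z.1 w.1.

Lemma mismatch_form_gt0 lam mu n om z : mismatched_pair lam mu n om z ->
  0 < mismatch_form lam mu n z z.
Proof.
move=> [E [[_ z1] [_ z2] zn]].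
by rewrite /mismatch_form z1 z2 !mulr1 -!expr2 subr_gt0.
Qed.

(* Both products in the form are equal to
   [(E - E') * ip z.1 w.1 * ip z.2 w.2 / (a - b)]. *)
Lemma mismatch_form_eq0 lam mu n om a b z w : a != b ->
  mismatched_pair lam mu n [eta om with n |-> a] z ->
  mismatched_pair lam mu n [eta om with n |-> b] w ->
  mismatch_form lam mu n z w = 0.
Proof.
rewrite -subr_eq0 => ab [E [[z1 _] [z2 _] _]] [E' [[w1 _] [w2 _] _]].
have off_site nu m : m != n ->
    (nu \*o [eta om with n |-> a]) m = (nu \*o [eta om with n |-> b]) m.
  by move=> /= /negPf ->.
have := l2sol_perturbation (off_site lam) z1 w1.
have := l2sol_perturbation (off_site mu) z2 w2.
rewrite /= eqxx -!mulrBr => muE lamE; apply: (mulfI ab); rewrite mulr0 mulrBr.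
apply/eqP; rewrite subr_eq0; apply/eqP.
transitivity (lam * (a - b) * (z.1 n * w.1 n) * ip z.2 w.2); first by ring.
by rewrite lamE mulrAC -muE; ring.
Qed.

Lemma cvg_mismatch_form lam mu n z : (sqball 1 `*` sqball 1) z ->
  mismatch_form lam mu n z w
    @[w --> within (sqball 1 `*` sqball 1) (nbhs z)] -->
  mismatch_form lam mu n z z.
Proof.
move=> [z1 z2]; set F := within _ _.
have lz1 : l2 z.1 by exists 1.
have lz2 : l2 z.2 by exists 1.
have cvg1 : w.1 @[w --> F] --> z.1.
  by apply: cvg_within_filter; exact: cvg_fst.
have cvg2 : w.2 @[w --> F] --> z.2.
  by apply: cvg_within_filter; exact: cvg_snd.
have coord1 m := @cvg_coord R (Zd d) _ F fst z.1 m cvg1.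
have coord2 m := @cvg_coord R (Zd d) _ F snd z.2 m cvg2.
have inball : \forall w \near F, (sqball 1 `*` sqball 1) w by exact: withinT.
have ball1 : \forall w \near F, sqball 1 w.1 by apply: filterS inball => w [].
have ball2 : \forall w \near F, sqball 1 w.2 by apply: filterS inball => w [].
apply: cvgB; apply: cvgM; do ?exact: (cvg_ip (c := 1)).
- by apply: cvgM; [exact: cvg_cst|apply: cvgM => //; exact: cvg_cst].
- by apply: cvgM; [exact: cvg_cst|apply: cvgM => //; exact: cvg_cst].
Qed.

Lemma countable_slope_mismatch lam mu n om :
  countable [set a | slope_mismatch lam mu n [eta om with n |-> a]].
Proof.
set S := [set a | _].
pose pair_at a : pair_space :=
  xget (fun=> 0, fun=> 0) (mismatched_pair lam mu n [eta om with n |-> a]).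
have pair_atP a : S a ->
    mismatched_pair lam mu n [eta om with n |-> a] (pair_at a).
  by move=> [z az]; exact: (xgetPex _ (ex_intro _ z az)).
have pair_at_ball a : S a -> (sqball 1 `*` sqball 1) (pair_at a).
  move=> /pair_atP[E [[[l1 _] norm1] [[l2 _] norm2] _]].
  by split; [rewrite -norm1|rewrite -norm2]; exact: sqball_ip.
apply: (countable_isolated _ pair_at_ball) => [|a Sa].
  by apply: compact_setX; exact: compact_sqball.
have form_near := cvgr_gt _ (cvg_mismatch_form (pair_at_ball a Sa)) _
  (mismatch_form_gt0 (pair_atP a Sa)).
rewrite near_withinE in form_near; near=> w => b Sb pair_b.
have form_gt0 : 0 < mismatch_form lam mu n (pair_at a) (pair_at b).
  have := pair_at_ball b Sb; rewrite pair_b.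
  by near: w; exact: form_near.
apply/eqP; apply: contraTT form_gt0; rewrite eq_sym => ab.
by rewrite (mismatch_form_eq0 ab (pair_atP a Sa) (pair_atP b Sb)) ltxx.
Unshelve. all: by end_near. Qed.

End ScalarModel.

Section BoundedMismatch.
Variables (R : realType) (d : nat) (lam mu : R) (n : Zd d).
Implicit Types (V om f g : Zd d -> R) (E : R) (m : Zd d).

Local Notation triple_space := (R * {ptws Zd d -> R} * {ptws Zd d -> R})%type.

Definition residual V E f m : R := lap f m + V m * f m - E * f m.

Lemma cvg_residual (T : Type) (F : set_system T) {FF : Filter F} V E f m
    (E_ : T -> R) (f_ : T -> Zd d -> R) :
  E_ t @[t --> F] --> E -> (forall m, f_ t m @[t --> F] --> f m) ->
  residual V (E_ t) (f_ t) m @[t --> F] --> residual V E f m.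
Proof.
move=> cvgE cvgf; apply: cvgB; last exact: cvgM.
apply: cvgD; last by apply: cvgM => //; exact: cvg_cst.
by apply: cvg_big => [|i _]; [exact: add_continuous|exact: cvgD].
Qed.

Lemma measurable_residual (dX : measure_display) (X : measurableType dX)
    (V : X -> Zd d -> R) E f m : measurable_fun setT (V ^~ m) ->
  measurable_fun setT (fun x => residual (V x) E f m).
Proof.
by move=> mV; apply: measurable_funB => //; apply: measurable_funD => //;
  exact: measurable_funM.
Qed.

Variables (M p : nat) (A : {fset Zd d}).

(* [None] indexes the inequality between the slopes. *)
Definition mismatch_constraint (o : option (Zd d)) om E f g : R :=
  if o is Some m then
    `|residual (lam \*o om) E f m| + `|residual (mu \*o om) E g m|
  else mu * g n ^+ 2 + p.+1%:R^-1 - lam * f n ^+ 2 * \sum_(m <- A) g m ^+ 2.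

(* In contrast with those of [slope_mismatch], these conditions are preserved by
   pointwise limits. *)
Definition bounded_mismatch om := exists2 z : triple_space,
  ((`[- M%:R, M%:R] : set R) `*` sqball 1 `*` sqball 1) z &
  forall o, mismatch_constraint o om z.1.1 z.1.2 z.2 <= 0.

Lemma cvg_mismatch_constraint (T : Type) (F : set_system T) {FF : Filter F}
    o om E f g (E_ : T -> R) (f_ g_ : T -> Zd d -> R) :
  E_ t @[t --> F] --> E -> (forall m, f_ t m @[t --> F] --> f m) ->
  (forall m, g_ t m @[t --> F] --> g m) ->
  mismatch_constraint o om (E_ t) (f_ t) (g_ t) @[t --> F] -->
    mismatch_constraint o om E f g.
Proof.
move=> cvgE cvgf cvgg; case: o => [m|].
  by apply: cvgD; apply: cvg_norm; exact: cvg_residual.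
have cvg_sqr (h_ : T -> R) (h : R) : h_ t @[t --> F] --> h ->
    h_ t ^+ 2 @[t --> F] --> h ^+ 2.
  by move=> cvgh; exact: (cvg_comp _ _ cvgh (@exprn_continuous _ 2 h)).
apply: cvgB; [apply: cvgD; [|exact: cvg_cst]|apply: cvgM].
- by apply: cvgM; [exact: cvg_cst|exact: cvg_sqr].
- by apply: cvgM; [exact: cvg_cst|exact: cvg_sqr].
- by apply: cvg_big => [|m _]; [exact: add_continuous|exact: cvg_sqr].
Qed.

Lemma continuous_mismatch_constraint o om : continuous
  (fun z : triple_space => mismatch_constraint o om z.1.1 z.1.2 z.2).
Proof.
move=> z; have cvg1 : w.1 @[w --> z] --> z.1 by exact: cvg_fst.
have cvg2 : w.2 @[w --> z] --> z.2 by exact: cvg_snd.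
have cvg11 : w.1.1 @[w --> z] --> z.1.1.
  by apply: (cvg_comp _ _ cvg1); exact: cvg_fst.
have cvg12 : w.1.2 @[w --> z] --> z.1.2.
  by apply: (cvg_comp _ _ cvg1); exact: cvg_snd.
exact: (@cvg_mismatch_constraint _ (nbhs z) _ o om _ _ _ _ _ _ cvg11
  (fun m => cvg_coord (i := m) cvg12) (fun m => cvg_coord (i := m) cvg2)).
Qed.

Lemma measurable_bounded_mismatch :
  measurable [set om : configuration R (Zd d) | bounded_mismatch om].
Proof.
apply: measurable_exists_le0.
- apply: compact_setX; last exact: compact_sqball.
  by apply: compact_setX; [exact: segment_compact|exact: compact_sqball].
- exact: continuous_mismatch_constraint.
case=> [m|] z; last exact: measurable_cst.
have measurable_norm_residual nu E f : measurable_fun setT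
    (fun om : configuration R (Zd d) => `|residual (nu \*o om) E f m|).
  apply: measurableT_comp => //; apply: measurable_residual.
  apply: measurable_funM => //.
  exact: (iffLR (measurable_configurationP _) (@measurable_id _ _ _)).
by apply: measurable_funD; exact: measurable_norm_residual.
Qed.

End BoundedMismatch.

Section MeasurableMismatch.
Variables (R : realType) (d : nat) (lam mu : R) (n : Zd d).
Hypotheses (lam0 : 0 <= lam) (mu0 : 0 <= mu).
Implicit Types om : Zd d -> R.

Lemma bounded_slope_mismatch M p A om :
  bounded_mismatch lam mu n M p A om -> slope_mismatch lam mu n om.
Proof.
move=> [[[E f] g] [[/= _ f1] g1] constraint].
have lf : l2 f by exists 1.
have lg : l2 g by exists 1.
have residual0 m :
    residual (lam \*o om) E f m = 0 /\ residual (mu \*o om) E g m = 0.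
  have : mismatch_constraint lam mu n p A (Some m) om E f g == 0.
    by rewrite eq_le (constraint (Some m)) addr_ge0.
  by rewrite /= paddr_eq0// !normr_eq0 => /andP[/eqP -> /eqP ->].
apply: (slope_mismatch_of_l2sol (E := E) (f := f) (g := g)) => //.
- by split=> // m; apply/subr0_eq/(residual0 m).1.
- by split=> // m; apply/subr0_eq/(residual0 m).2.
have := constraint None; rewrite /= subr_le0 => gap.
apply: (@le_lt_trans _ _ (mu * g n ^+ 2)).
  by apply: ler_piMr (ip_le_sqball f1); rewrite mulr_ge0 ?sqr_ge0.
apply: (@lt_le_trans _ _ (mu * g n ^+ 2 + p.+1%:R^-1)).
  by rewrite ltrDl invr_gt0.
apply: le_trans gap _; apply: ler_wpM2l; first by rewrite mulr_ge0 ?sqr_ge0.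
exact: sqball_ip.
Qed.

Lemma slope_mismatch_bounded om : slope_mismatch lam mu n om ->
  exists M p A, bounded_mismatch lam mu n M p A om.
Proof.
move=> [[f g] [E [[[lf lamf] f1] [[lg mug] g1] /= fg]]].
have cvg_slope : lam * f n ^+ 2 * partial_sum (g \* g) A
    @[A --> totally] --> lam * f n ^+ 2.
  rewrite -[X in _ --> X]mulr1 -g1.
  by apply: cvgM; [exact: cvg_cst|exact: has_sum_ip].
have [A slopeA] := filter_ex (cvgr_gt _ cvg_slope _ fg).
have [p gap] := ltr_add_invr slopeA.
exists (Num.truncn `|E|).+1, p, A, (E, f, g); first split; first split => /=.
- by rewrite in_itv/= -ler_norml ltW// truncnS_gt.
- by rewrite -f1; exact: sqball_ip.
- by rewrite -g1; exact: sqball_ip.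
case=> [m|] /=; first by rewrite /residual lamf mug !subrr normr0 addr0.
by rewrite subr_le0 (ltW (lt_le_trans gap _))// partial_sumE.
Qed.

Lemma measurable_slope_mismatch :
  measurable [set om : configuration R (Zd d) | slope_mismatch lam mu n om].
Proof.
have -> : [set om : configuration R (Zd d) | slope_mismatch lam mu n om] =
    \bigcup_(c in [set: nat * nat * {fset Zd d}])
      [set om | bounded_mismatch lam mu n c.1.1 c.1.2 c.2 om].
  apply/seteqP; split=> om /=.
    by move=> /slope_mismatch_bounded[M [p [A bounded]]]; exists (M, p, A).
  by move=> [c _]; exact: bounded_slope_mismatch.
apply: countable_bigcupT_measurable => [|c]; first exact: countableP.
exact: measurable_bounded_mismatch.
Qed.

End MeasurableMismatch.

Lemma ae_forall_countable (d : measure_display) (T : measurableType d)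
    (R : realType) (mu : {measure set T -> \bar R}) (I : countType)
    (Q : I -> T -> Prop) :
  (forall i, {ae mu, forall t, Q i t}) -> {ae mu, forall t, forall i, Q i t}.
Proof.
move=> aeQ; pose Qn k t := if unpickle k is Some i then Q i t else True.
have : {ae mu, forall t, forall k, Qn k t}.
  apply: ae_foralln => k; rewrite /Qn; case: unpickle => [i|]; first exact: aeQ.
  exact: aeW.
by apply: filterS => t Qt i; have := Qt (pickle i); rewrite /Qn pickleK.
Qed.

Section AlmostSure.
Variables (R : realType) (d : nat) (rho : R -> R) (dT : measure_display).
Variables (T : measurableType dT) (P : probability T R).
Variable omega : Zd d -> T -> R.
Hypothesis rho_density : bdd_cpt_density rho.
Hypothesis momega : forall n, measurable_fun setT (omega n).
Hypothesis omega_density : forall n, has_density P (omega n) rho.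
Hypothesis omega_indep : mutually_independent P omega.

Lemma countable_law_null n (A : set R) : countable A ->
  P (omega n @^-1` A) = 0%E.
Proof.
move=> countableA; have mA : measurable A by exact: countable_measurable.
rewrite (omega_density n mA); apply: null_set_integral => //.
  by apply/measurable_EFinP; apply: measurable_funS rho_density.1.
exact: countable_lebesgue_measure0.
Qed.

Lemma ae_no_slope_mismatch lam mu n : 0 <= lam -> 0 <= mu ->
  {ae P, forall t, ~ slope_mismatch lam mu n (omega ^~ t)}.
Proof.
move=> lam0 mu0; have mB := measurable_slope_mismatch n lam0 mu0.
exists [set t | slope_mismatch lam mu n (omega ^~ t)].
split=> [||t /contrapT//].
  rewrite -[X in measurable X]setTI.
  exact: (measurable_config momega measurableT mB).
apply: (null_of_null_sections momega omega_indep mB) => om.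
exact/countable_law_null/countable_slope_mismatch.
Qed.

End AlmostSure.

Section SlopesAgree.
Variables (R : realType) (d : nat) (om : Zd d -> R).
Implicit Types (f g : Zd d -> R) (lam mu : R).

Definition slopes_agree lam mu := forall n,
  ~ slope_mismatch lam mu n om /\ ~ slope_mismatch mu lam n om.

Lemma slopes_agree_l2sol lam mu E f g n : 0 <= lam -> 0 <= mu ->
  slopes_agree lam mu -> l2sol (lam \*o om) E f -> l2sol (mu \*o om) E g ->
  mu * g n ^+ 2 * ip f f = lam * f n ^+ 2 * ip g g.
Proof.
move=> lam0 mu0 agree lamf mug; have [no_fg no_gf] := agree n.
apply/le_anti/andP; split; rewrite leNgt; apply/negP => lt.
- exact: no_gf (slope_mismatch_of_l2sol mu0 lam0 mug lamf lt).
- exact: no_fg (slope_mismatch_of_l2sol lam0 mu0 lamf mug lt).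
Qed.

(* Summing the equality of the slopes over all sites yields
   [(lam - mu) * ip f f * ip g g = 0]. *)
Lemma slopes_agree_eq0 lam mu E f g n : lam != mu -> 0 <= lam -> 0 <= mu ->
  slopes_agree lam mu -> l2sol (lam \*o om) E f -> l2sol (mu \*o om) E g ->
  f n != 0 -> forall m, g m = 0.
Proof.
move=> neq lam0 mu0 agree lamf mug fn0.
have [[lf _] [lg _]] := (lamf, mug); have f0 := ip_gt0 lf fn0.
apply: ip_eq0 => //; apply/eqP.
have sum_lam := has_sumZ (c := lam * ip g g) (has_sum_ip lf lf).
have := has_sumZ (c := mu * ip f f) (has_sum_ip lg lg).
have -> : mu * ip f f \*o (g \* g) = lam * ip g g \*o (f \* f).
  apply/funext => m /=; have := slopes_agree_l2sol m lam0 mu0 agree lamf mug.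
  by rewrite -!expr2 mulrAC => ->; rewrite mulrAC.
move=> /(has_sum_unique sum_lam) lam_mu.
have /eqP : (lam - mu) * ip f f * ip g g = 0 by lra.
by rewrite !mulf_eq0 subr_eq0 (negPf neq) (gt_eqF f0).
Qed.

(* The combination of [f] and [g] that vanishes at [n] has slope 0 there,
   whereas the slope of [f] is positive. *)
Lemma slopes_agree_collinear lam E f g n : 0 < lam -> slopes_agree lam lam ->
  l2sol (lam \*o om) E f -> l2sol (lam \*o om) E g -> f n != 0 ->
  exists r, forall m, g m = r * f m.
Proof.
move=> lam0 agree lamf lamg fn0; exists (g n / f n) => m.
pose h := g \+ (- (g n / f n)) \*o f.
have lamh : l2sol (lam \*o om) E h by apply: l2solD => //; exact: l2solZ.
have hn : h n = 0 by rewrite /h /= mulNr divfK// subrr.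
have := slopes_agree_l2sol n (ltW lam0) (ltW lam0) agree lamf lamh.
rewrite hn expr0n/= mulr0 mul0r => /esym/eqP.
rewrite 2!mulf_eq0 sqrf_eq0 (gt_eqF lam0) (negPf fn0) /= => /eqP h0.
by have := ip_eq0 lamh.1 h0 m; rewrite /h /= mulNr => /subr0_eq.
Qed.

End SlopesAgree.

Local Open Scope complex_scope.

Section ComplexSolutions.
Variables (R : realType) (d : nat).
Implicit Types (V om f : Zd d -> R) (lam mu : R).
Implicit Types (E : R[i]) (u v : Zd d -> R[i]).

(* [Re] and [Im] are linear over R only on the alias [Rcomplex R] of [R[i]]. *)
Local Notation Re := (@complex.Re R : Rcomplex R -> R).
Local Notation Im := (@complex.Im R : Rcomplex R -> R).

Lemma ReM (x y : R[i]) : Re (x * y) = Re x * Re y - Im x * Im y.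
Proof. by case: x; case: y. Qed.

Lemma ImM (x y : R[i]) : Im (x * y) = Re x * Im y + Im x * Re y.
Proof. by case: x; case: y. Qed.

Definition complex_l2sol V E u :=
  [/\ l2 (Re \o u), l2 (Im \o u) & eigen_eq (fun m => (V m)%:C) E u].

Lemma eigen_eq_Re V E u m : complex_l2sol V E u ->
  lap (Re \o u) m + V m * Re (u m) = Re E * Re (u m) - Im E * Im (u m).
Proof.
move=> [_ _ /(_ m)/(congr1 Re)]; rewrite -ReM => <-.
rewrite raddfD/= ReM/= mul0r subr0; congr (_ + _).
exact: (lap_additive Re).
Qed.

Lemma eigen_eq_Im V E u m : complex_l2sol V E u ->
  lap (Im \o u) m + V m * Im (u m) = Re E * Im (u m) + Im E * Re (u m).
Proof.
move=> [_ _ /(_ m)/(congr1 Im)]; rewrite -ImM => <-.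
rewrite raddfD/= ImM/= mul0r addr0; congr (_ + _).
exact: (lap_additive Im).
Qed.

Lemma complex_l2sol_real V E u m : complex_l2sol V E u -> u m != 0 -> Im E = 0.
Proof.
move=> Vu um0; have [lr li _] := Vu.
have green : has_sum (lap (Re \o u) \* (Im \o u) \- (Re \o u) \* lap (Im \o u))
    (- Im E * (ip (Re \o u) (Re \o u) + ip (Im \o u) (Im \o u))).
  have := has_sumZ (c := - Im E)
    (has_sumD (has_sum_ip lr lr) (has_sum_ip li li)).
  congr has_sum; apply/funext => x /=.
  rewrite (canRL (addrK _) (eigen_eq_Re x Vu)).
  by rewrite (canRL (addrK _) (eigen_eq_Im x Vu)); ring.
have /eqP := has_sum_unique green (has_sum_green lr li).
rewrite mulf_eq0 oppr_eq0 paddr_eq0 ?ip_ge0//.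
move=> /orP[/eqP //|/andP[/eqP r0 /eqP i0]].
have /= um_r := ip_eq0 lr r0 m; have /= um_i := ip_eq0 li i0 m.
by move: um0; rewrite eq_complex um_r um_i !eqxx.
Qed.

Lemma complex_l2sol_parts V E u : complex_l2sol V E u -> Im E = 0 ->
  l2sol V (Re E) (Re \o u) /\ l2sol V (Re E) (Im \o u).
Proof.
move=> Vu E0; have [lr li _] := Vu; split; split=> // m.
  by rewrite (eigen_eq_Re m Vu) E0 mul0r subr0.
by rewrite (eigen_eq_Im m Vu) E0 mul0r addr0.
Qed.

Lemma complex_l2sol_nonzero_part V E u m : complex_l2sol V E u -> u m != 0 ->
  exists f n, l2sol V (Re E) f /\ f n != 0.
Proof.
move=> Vu um0.
have [Vr Vi] := complex_l2sol_parts Vu (complex_l2sol_real Vu um0).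
move: um0; rewrite eq_complex negb_and => /orP[] ?.
- by exists (Re \o u), m.
- by exists (Im \o u), m.
Qed.

Lemma complex_slopes_agree_eq0 om lam mu E u v n : lam != mu ->
  0 <= lam -> 0 <= mu -> slopes_agree om lam mu ->
  complex_l2sol (lam \*o om) E u -> complex_l2sol (mu \*o om) E v ->
  u n != 0 -> forall m, v m = 0.
Proof.
move=> neq lam0 mu0 agree lamu muv un0 m.
have [vr vi] := complex_l2sol_parts muv (complex_l2sol_real lamu un0).
have [f [x [lamf fx0]]] := complex_l2sol_nonzero_part lamu un0.
have part0 g := slopes_agree_eq0 (g := g) neq lam0 mu0 agree lamf ^~ fx0.
have /= vr0 := part0 _ vr m; have /= vi0 := part0 _ vi m.
by apply/eqP; rewrite eq_complex vr0 vi0 !eqxx.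
Qed.

Lemma complex_multiple_of_real om lam E f v n :
  0 < lam -> slopes_agree om lam lam -> Im E = 0 ->
  l2sol (lam \*o om) (Re E) f -> f n != 0 -> complex_l2sol (lam \*o om) E v ->
  exists z : R[i], forall m, v m = z * (f m)%:C.
Proof.
move=> lam0 agree E0 lamf fn0 lamv.
have [vr vi] := complex_l2sol_parts lamv E0.
have [r vrE] := slopes_agree_collinear lam0 agree lamf vr fn0.
have [s viE] := slopes_agree_collinear lam0 agree lamf vi fn0.
exists (r +i* s) => m; move: (vrE m) (viE m) => /=.
by case: (v m) => x y /= -> ->; rewrite /GRing.mul /= !mulr0 subr0 add0r.
Qed.

Lemma complex_slopes_agree_collinear om lam E u v n :
  0 < lam -> slopes_agree om lam lam ->
  complex_l2sol (lam \*o om) E u -> complex_l2sol (lam \*o om) E v ->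
  u n != 0 -> exists c, forall m, v m = c * u m.
Proof.
move=> lam0 agree lamu lamv un0; have E0 := complex_l2sol_real lamu un0.
have [f [x [lamf fx0]]] := complex_l2sol_nonzero_part lamu un0.
have [z uE] := complex_multiple_of_real lam0 agree E0 lamf fx0 lamu.
have [w vE] := complex_multiple_of_real lam0 agree E0 lamf fx0 lamv.
have z0 : z != 0 by apply: contraNneq un0 => z0; rewrite uE z0 mul0r.
by exists (w / z) => m; rewrite uE vE mulrA divfK.
Qed.

End ComplexSolutions.

Lemma simple_spectrum_diag (F : fieldType) (k : nat) (W : 'M[F]_k)
    (s : seq F) :
  uniq s -> size s = k -> all (eigenvalue W) s ->
  exists (V : 'M[F]_k) (lam : 'I_k -> F),
    [/\ V \in unitmx, injective lam, forall j, eigenvalue W (lam j) &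
        V *m W = diag_mx (\row_j lam j) *m V].
Proof.
move=> uniq_s size_s /allP eig_s; pose lam (j : 'I_k) := nth 0 s j.
have lam_inj : injective lam.
  by move=> i j /eqP; rewrite nth_uniq ?size_s// => /eqP; exact: val_inj.
have eig_lam j : eigenvalue W (lam j) by apply: eig_s; rewrite mem_nth// size_s.
have /choice[v vP] : forall j, exists v : 'rV[F]_k,
    v *m W = lam j *: v /\ v != 0.
  by move=> j; have /eigenvalueP[v vW v0] := eig_lam j; exists v.
exists (\matrix_j v j), lam; split=> //; last first.
  apply/row_matrixP => j; rewrite row_mul rowK (vP j).1 mul_diag_mx.
  by apply/rowP => l; rewrite !mxE.
rewrite -row_free_unit; apply: inj_row_free => u uV; apply/rowP => i.
have /mxdirect_sumsP/(_ i isT) direct :=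
  @mxdirect_sum_eigenspace _ _ _ W predT lam (in2W lam_inj).
have in_eigenspace j : (u 0 j *: v j <= eigenspace W (lam j))%MS.
  by apply/scalemx_sub/eigenspaceP; exact: (vP j).1.
have : (u 0 i *: v i <= (0 : 'M[F]_k))%MS.
  rewrite -direct sub_capmx in_eigenspace /=.
  have /eqP : \sum_j u 0 j *: v j = 0.
    by rewrite -[RHS]uV mulmx_sum_row; apply: eq_bigr => j _; rewrite rowK.
  rewrite (bigD1 i)//= addr_eq0 => /eqP ->.
  by rewrite eqmx_opp; apply: summx_sub_sums => j _; exact: in_eigenspace.
by rewrite submx0 scaler_eq0 (negPf (vP i).2) orbF mxE => /eqP.
Qed.

Lemma posdef_eigenvalue_gt0 (R : realType) (k : nat) (W : 'M[R]_k) a :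
  sym_posdef W -> eigenvalue W a -> 0 < a.
Proof.
move=> [_ posW] /eigenvalueP[v vW]; rewrite -trmx_eq0 => /posW.
rewrite trmxK vW -scalemxAl mxE; apply: contraTT; rewrite -!leNgt => a0.
apply: mulr_le0_ge0 => //; rewrite mxE sumr_ge0// => i _.
by rewrite mxE -expr2 sqr_ge0.
Qed.

Section Diagonalization.
Variables (R : realType) (d k : nat) (W : 'M[R]_k) (om : Zd d -> R).
Variables (V : 'M[R]_k) (lam : 'I_k -> R).
Hypothesis VW : V *m W = diag_mx (\row_j lam j) *m V.
Implicit Types phi psi : Zd d -> 'cV[R[i]]_k.

Local Notation complexify := (map_mx (real_complex R)).

Definition coordinate phi (j : 'I_k) (m : Zd d) : R[i] :=
  (complexify V *m phi m) j 0.

Lemma l2_entry phi l : in_l2 phi ->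
  l2 (fun m => complex.Re (phi m l 0)) /\ l2 (fun m => complex.Im (phi m l 0)).
Proof.
move=> [c phic].
have entry_le m : complex.Re (phi m l 0) ^+ 2 + complex.Im (phi m l 0) ^+ 2 <=
    sqnorm (phi m).
  rewrite /sqnorm (bigD1 l)//= lerDl sumr_ge0// => i _.
  by rewrite addr_ge0 ?sqr_ge0.
split; exists c => A; apply: le_trans (phic A (fset_uniq A));
  apply: ler_sum => m _; apply: le_trans (entry_le m).
- by rewrite lerDl sqr_ge0.
- by rewrite lerDr sqr_ge0.
Qed.

Lemma l2_coordinate (part : {linear Rcomplex R -> R}) phi j :
  (forall l, l2 (fun m => part (phi m l 0))) -> l2 (part \o coordinate phi j).
Proof.
move=> l2phi.
have -> : part \o coordinate phi j =
    fun m => \sum_l V j l * part (phi m l 0).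
  apply/funext => m; rewrite /coordinate /= mxE linear_sum.
  apply: eq_bigr => l _.
  transitivity (part (V j l *: (phi m l 0 : Rcomplex R))); last exact: linearZ.
  rewrite mxE; case: (phi m l 0) => x y.
  by rewrite {1}/GRing.mul/= !mul0r subr0 addr0.
by apply: l2_sum => l; exact: l2Z.
Qed.

Lemma coordinate_l2sol phi E j : in_l2 phi ->
  (forall m, HA W om phi m = E *: phi m) ->
  complex_l2sol (lam j \*o om) E (coordinate phi j).
Proof.
move=> l2phi Hphi; split=> [||m].
- apply: (@l2_coordinate (@complex.Re R : Rcomplex R -> R)) => l.
  exact: (l2_entry l l2phi).1.
- apply: (@l2_coordinate (@complex.Im R : Rcomplex R -> R)) => l.
  exact: (l2_entry l l2phi).2.
have -> : lap (coordinate phi j) m = (complexify V *m laplacian phi m) j 0.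
  rewrite mulmx_sumr summxE; apply: eq_bigr => i _.
  by rewrite mulmxDr [RHS]mxE.
have -> : (lam j * om m)%:C * coordinate phi j m =
    (complexify V *m ((om m)%:C *: (complexify W *m phi m))) j 0.
  rewrite -scalemxAr mulmxA -map_mxM VW map_mxM -mulmxA map_diag_mx.
  rewrite mul_diag_mx 2!mxE -/(coordinate phi j m) !mxE mulrA.
  by rewrite [X in _ = X * _]mulrC -rmorphM.
have := congr1 (fun x => (complexify V *m x) j 0) (Hphi m).
by rewrite /HA mulmxDr [LHS]mxE => ->; rewrite -scalemxAr mxE.
Qed.

Hypotheses (unitV : V \in unitmx) (lam_inj : injective lam).
Hypothesis lam_gt0 : forall j, 0 < lam j.

Lemma coordinate_inj (x y : 'cV[R[i]]_k) :
  (forall j, (complexify V *m x) j 0 = (complexify V *m y) j 0) -> x = y.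
Proof.
move=> xy; have unitVC : complexify V \in unitmx by rewrite map_unitmx.
by apply: (can_inj (mulKmx unitVC)); apply/colP.
Qed.

Lemma slopes_agree_simple : (forall i j, slopes_agree om (lam i) (lam j)) ->
  all_eigenvalues_simple (HA W om).
Proof.
move=> agree E phi psi [l2phi [[n phin0] Hphi]] [l2psi [_ Hpsi]].
have phi_sol j := coordinate_l2sol j l2phi Hphi.
have psi_sol j := coordinate_l2sol j l2psi Hpsi.
have [j phij0] : exists j, coordinate phi j n != 0.
  apply/existsP; apply: contraNT phin0 => /existsPn phi0.
  apply/eqP/coordinate_inj => j; rewrite mulmx0 [RHS]mxE.
  exact: eqP (negbNE (phi0 j)).
have [c psiE] := complex_slopes_agree_collinear (lam_gt0 j) (agree j j)
  (phi_sol j) (psi_sol j) phij0.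
exists c => m; apply: coordinate_inj => l; rewrite -scalemxAr [RHS]mxE.
have [->|lj] := eqVneq l j; first exact: psiE.
have lam_neq : lam j != lam l by rewrite (inj_eq lam_inj) eq_sym.
have coordinate0 u := complex_slopes_agree_eq0 (v := u) lam_neq
  (ltW (lam_gt0 j)) (ltW (lam_gt0 l)) (agree j l) (phi_sol j) ^~ phij0.
have := coordinate0 _ (psi_sol l) m; have := coordinate0 _ (phi_sol l) m.
by rewrite /coordinate => -> ->; rewrite mulr0.
Qed.

End Diagonalization.

Local Close Scope complex_scope.

Theorem theorem1p2 (R : realType) (d k : nat) (W : 'M[R]_k)
  (rho : R -> R) (dT : measure_display) (T : measurableType dT)
  (P : probability T R) (omega : Zd d -> T -> R) :
  sym_posdef W -> simple_spectrum W ->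
  bdd_cpt_density rho ->
  (forall n, measurable_fun setT (omega n)) ->
  (forall n, has_density P (omega n) rho) ->
  mutually_independent P omega ->
  {ae P, forall t, all_eigenvalues_simple (HA W (fun n => omega n t))}.
Proof.
move=> posW [s [uniq_s size_s eig_s]] density_rho momega dens indep.
have [V [lam [unitV lam_inj eig_lam VW]]] :=
  simple_spectrum_diag uniq_s size_s eig_s.
have lam_gt0 j := posdef_eigenvalue_gt0 posW (eig_lam j).
have : {ae P, forall t, forall c : 'I_k * 'I_k * Zd d,
    ~ slope_mismatch (lam c.1.1) (lam c.1.2) c.2 (omega ^~ t)}.
  apply: ae_forall_countable => c.
  by apply: (ae_no_slope_mismatch density_rho) => //; exact: ltW.
apply: filterS => t no_mismatch.
apply: (slopes_agree_simple VW unitV lam_inj lam_gt0) => i j n.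
by split; [exact: (no_mismatch (i, j, n))|exact: (no_mismatch (j, i, n))].
Qed.
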